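(* The maps $\operatorname{Res}\colon \mathrm{Sch}\to p\mathrm{Sch}$ and $\operatorname{Ord}\colon p\mathrm{Sch}\to\mathrm{Sch}$ are homomorphisms of complete lattices and, for every $p$-Schunck class $\mathfrak{K}$ which contains all atoms (that is, every $\mathfrak{K}\in p\mathrm{Sch}$), $$\operatorname{Res}(\operatorname{Ord}(\mathfrak{K}))=\mathfrak{K}.$$
   Context: All Lie algebras are finite-dimensional over a fixed field $F$ of characteristic $p\neq 0$. A restricted Lie algebra $(L,[p])$ is a Lie algebra $L$ with a $p$-operation $x\mapsto x^{[p]}$ in the usual sense; it is soluble if the Lie algebra $L$ is. A $[p]$-subalgebra is a subalgebra $U$ with $U^{[p]}\subseteq U$; a $[p]$-ideal is an ideal which is a $[p]$-subalgebra; for a $[p]$-ideal $K$, $L/K$ carries the induced $p$-operation. Classes of (restricted) Lie algebras are closed under isomorphism. Ordinary soluble Lie algebras: $L$ is primitive if it has a minimal (nonzero) ideal $A$ with centraliser $\mathcal{C}_L(A)=A$. For a class $\mathfrak{X}$ of soluble Lie algebras, $\mathrm{P}\mathfrak{X}$ denotes the class of all soluble Lie algebras all of whose primitive quotients are in $\mathfrak{X}$; a Schunck class is a non-empty class $\mathfrak{X}$ with $\mathrm{P}\mathfrak{X}=\mathfrak{X}$. $\mathrm{Sch}$ is the collection of all nonzero Schunck classes (those containing some nonzero algebra), partially ordered by inclusion. Soluble restricted Lie algebras: $(L,[p])$ is primitive if it has a minimal (nonzero) $[p]$-ideal $A$ with $\mathcal{C}_L(A)=A$. For a class $\mathfrak{X}$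 of soluble restricted Lie algebras, $\mathrm{P}\mathfrak{X}$ denotes the class of all soluble restricted Lie algebras all of whose primitive quotients (by $[p]$-ideals) are in $\mathfrak{X}$; a $p$-Schunck class is a non-empty class $\mathfrak{X}$ with $\mathrm{P}\mathfrak{X}=\mathfrak{X}$. An atom is a nonzero soluble restricted Lie algebra whose only $[p]$-subalgebras are $0$ and itself. $p\mathrm{Sch}$ is the collection of all $p$-Schunck classes containing all atoms, partially ordered by inclusion. In both $\mathrm{Sch}$ and $p\mathrm{Sch}$ the meet of a family is its intersection, and the join of a family $(\mathfrak{H}_i)$ is $\sum_i\mathfrak{H}_i=\mathrm{P}\bigl(\bigcup_i\operatorname{Skel}(\mathfrak{H}_i)\bigr)$, where $\operatorname{Skel}(\mathfrak{H})$ is the class of all primitive algebras in $\mathfrak{H}$. A homomorphism of complete lattices is a map preserving meets and joins of arbitrary non-empty families. For a class $\mathfrak{H}$ of soluble Lie algebras, $\operatorname{Res}(\mathfrak{H})$ is the class of all restricted Lie algebras $(L,[p])$ with $L\in\mathfrak{H}$. For a class $\mathfrak{K}$ of soluble restricted Lie algebras, $\operatorname{Und}(\mathfrak{K})$ is the class of underlying Lie algebras of members of $\mathfrak{K}$, and for a $p$-Schunck class $\mathfrak{K}$, $\operatorname{Ord}(\mathfrak{K})=\mathrm{P}(\operatorname{Und}(\mathfrak{K}))$. *)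

(* Defs.v *)
From mathcomp Require Import all_boot all_order all_algebra.

Set Implicit Arguments.
Unset Strict Implicit.
Unset Printing Implicit Defensive.

Import GRing.Theory.
Local Open Scope ring_scope.

(* Classes of algebras are predicates on the (large) type of algebras; they   *)
(* are compared extensionally, as [set] from mathcomp-classical cannot be     *)
(* instantiated at this type for universe reasons.                            *)
Definition aclass (T : Type) := T -> Prop.

Definition class_eq (T : Type) (X Y : aclass T) : Prop :=
  forall L, X L <-> Y L.

Definition class_inter (T I : Type) (X : I -> aclass T) : aclass T :=
  fun L => forall i, X i L.

Definition class_union (T I : Type) (X : I -> aclass T) : aclass T :=
  fun L => exists i, X i L.

Section OrdinaryAlgebras.
Variable F : fieldType.

Record lieAlgebra := LieAlgebra {
  lie_carrier :> vectType F;
  bracket : lie_carrier -> lie_carrier -> lie_carrier;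
  bracketPl : forall (a : F) (x y z : lie_carrier),
    bracket (a *: x + y) z = a *: bracket x z + bracket y z;
  bracketPr : forall (a : F) (x y z : lie_carrier),
    bracket z (a *: x + y) = a *: bracket z x + bracket z y;
  bracketxx : forall x : lie_carrier, bracket x x = 0;
  jacobi : forall x y z : lie_carrier,
    bracket x (bracket y z) + bracket y (bracket z x)
      + bracket z (bracket x y) = 0
}.

Definition nonzero (L : lieAlgebra) : Prop := exists x : L, x <> 0.

Definition subalgebra (L : lieAlgebra) (U : {vspace L}) : Prop :=
  forall x y : L, x \in U -> y \in U -> bracket x y \in U.

Definition ideal (L : lieAlgebra) (K : {vspace L}) : Prop :=
  forall x y : L, x \in K -> bracket x y \in K.

(* As for [prodv], the span of the brackets of basis elements is the span of  *)
(* all brackets [u, v] with u in U and v in V, by bilinearity.                *)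
Definition bracketv (L : lieAlgebra) (U V : {vspace L}) : {vspace L} :=
  <<[seq bracket u v | u <- vbasis U, v <- vbasis V]>>%VS.

Definition derived_series (L : lieAlgebra) (n : nat) : {vspace L} :=
  iter n (fun U => bracketv U U) fullv.

Definition soluble (L : lieAlgebra) : Prop :=
  exists n, derived_series L n = 0%VS.

Definition self_centralising (L : lieAlgebra) (A : {vspace L}) : Prop :=
  forall x : L, (forall a : L, a \in A -> bracket x a = 0) <-> x \in A.

Definition minimal_ideal (L : lieAlgebra) (A : {vspace L}) : Prop :=
  [/\ ideal A, A <> 0%VS &
      forall B : {vspace L}, ideal B -> (B <= A)%VS -> B <> 0%VS -> B = A].

Definition primitive (L : lieAlgebra) : Prop :=
  exists A : {vspace L}, minimal_ideal A /\ self_centralising A.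

Definition lie_morphism (L M : lieAlgebra) (f : 'Hom(L, M)) : Prop :=
  forall x y : L, f (bracket x y) = bracket (f x) (f y).

Definition lie_iso (L M : lieAlgebra) : Prop :=
  exists f : 'Hom(L, M), lie_morphism f /\ bijective f.

(* Q is (isomorphic to) the quotient L / K, with projection f. *)
Definition is_quotient (L : lieAlgebra) (K : {vspace L}) (Q : lieAlgebra) :
    Prop :=
  exists f : 'Hom(L, Q), [/\ lie_morphism f, limg f = fullv & lker f = K].

Definition iso_closed (X : aclass lieAlgebra) : Prop :=
  forall L M : lieAlgebra, lie_iso L M -> X L -> X M.

Definition Pclosure (X : aclass lieAlgebra) : aclass lieAlgebra :=
  fun L => soluble L /\
    forall (K : {vspace L}) (Q : lieAlgebra),
      ideal K -> is_quotient K Q -> primitive Q -> X Q.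

Definition schunck (X : aclass lieAlgebra) : Prop :=
  [/\ iso_closed X, (exists L, X L) & class_eq (Pclosure X) X].

Definition Sch : aclass (aclass lieAlgebra) :=
  fun X => schunck X /\ exists L, X L /\ nonzero L.

Definition Skel (X : aclass lieAlgebra) : aclass lieAlgebra :=
  fun L => X L /\ primitive L.

Definition sch_meet (I : Type) (X : I -> aclass lieAlgebra) :
    aclass lieAlgebra :=
  class_inter X.

Definition sch_join (I : Type) (X : I -> aclass lieAlgebra) :
    aclass lieAlgebra :=
  Pclosure (class_union (fun i => Skel (X i))).

End OrdinaryAlgebras.

Section POperations.
Variables (F : fieldType) (p : nat) (L : lieAlgebra F).

(* An element of L[t] = L (x) F[t] is represented by its sequence of          *)
(* coefficients; this is the map ad(t x + y) on L[t].                         *)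
Definition ad_tx_y (x y : L) (g : nat -> L) : nat -> L :=
  fun k => (if k is k'.+1 then bracket x (g k') else 0) + bracket y (g k).

(* The coefficients of ad(t x + y)^(p - 1) (x). *)
Definition jacobson_poly (x y : L) : nat -> L :=
  iter p.-1 (ad_tx_y x y) (fun k => if k == 0%N then x else 0).

(* i s_i(x, y) is the coefficient of t^(i - 1) in ad(t x + y)^(p - 1) (x);    *)
(* i is invertible in F when 0 < i < p and F has characteristic p.            *)
Definition jacobson_s (i : nat) (x y : L) : L :=
  (i%:R : F)^-1 *: jacobson_poly x y i.-1.

Definition p_operation (q : L -> L) : Prop :=
  [/\ forall x z : L, bracket (q x) z = iter p (bracket x) z,
      forall (a : F) (x : L), q (a *: x) = a ^+ p *: q x &
      forall x y : L,
        q (x + y) = q x + q y + \sum_(1 <= i < p) jacobson_s i x y].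

End POperations.

Section RestrictedAlgebras.
Variables (F : fieldType) (p : nat).

Record restrictedLie := RestrictedLie {
  underlying :> lieAlgebra F;
  pop : underlying -> underlying;
  popP : p_operation p pop
}.

Definition p_stable (L : restrictedLie) (U : {vspace L}) : Prop :=
  forall x : L, x \in U -> pop x \in U.

Definition p_subalgebra (L : restrictedLie) (U : {vspace L}) : Prop :=
  subalgebra U /\ p_stable U.

Definition p_ideal (L : restrictedLie) (K : {vspace L}) : Prop :=
  ideal K /\ p_stable K.

Definition minimal_p_ideal (L : restrictedLie) (A : {vspace L}) : Prop :=
  [/\ p_ideal A, A <> 0%VS &
      forall B : {vspace L}, p_ideal B -> (B <= A)%VS -> B <> 0%VS -> B = A].

Definition p_primitive (L : restrictedLie) : Prop :=
  exists A : {vspace L}, minimal_p_ideal A /\ self_centralising A.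

Definition atom (L : restrictedLie) : Prop :=
  [/\ nonzero L, soluble L &
      forall U : {vspace L}, p_subalgebra U -> U = 0%VS \/ U = fullv].

Definition restricted_morphism (L M : restrictedLie) (f : 'Hom(L, M)) : Prop :=
  lie_morphism f /\ forall x : L, f (pop x) = pop (f x).

Definition restricted_iso (L M : restrictedLie) : Prop :=
  exists f : 'Hom(L, M), restricted_morphism f /\ bijective f.

(* Q is (isomorphic to) L / K with the induced p-operation. *)
Definition is_p_quotient (L : restrictedLie) (K : {vspace L})
    (Q : restrictedLie) : Prop :=
  exists f : 'Hom(L, Q),
    [/\ restricted_morphism f, limg f = fullv & lker f = K].

Definition p_iso_closed (X : aclass restrictedLie) : Prop :=
  forall L M : restrictedLie, restricted_iso L M -> X L -> X M.

Definition pPclosure (X : aclass restrictedLie) : aclass restrictedLie :=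
  fun L => soluble L /\
    forall (K : {vspace L}) (Q : restrictedLie),
      p_ideal K -> is_p_quotient K Q -> p_primitive Q -> X Q.

Definition p_schunck (X : aclass restrictedLie) : Prop :=
  [/\ p_iso_closed X, (exists L, X L) & class_eq (pPclosure X) X].

Definition pSch : aclass (aclass restrictedLie) :=
  fun X => p_schunck X /\ forall L, atom L -> X L.

Definition pSkel (X : aclass restrictedLie) : aclass restrictedLie :=
  fun L => X L /\ p_primitive L.

Definition psch_meet (I : Type) (X : I -> aclass restrictedLie) :
    aclass restrictedLie :=
  class_inter X.

Definition psch_join (I : Type) (X : I -> aclass restrictedLie) :
    aclass restrictedLie :=
  pPclosure (class_union (fun i => pSkel (X i))).

Definition Res (X : aclass (lieAlgebra F)) : aclass restrictedLie :=
  fun L => X (underlying L).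

Definition Und (X : aclass restrictedLie) : aclass (lieAlgebra F) :=
  fun L => exists (q : L -> L) (qP : p_operation p q), X (RestrictedLie qP).

Definition Ord (X : aclass restrictedLie) : aclass (lieAlgebra F) :=
  Pclosure (Und X).

End RestrictedAlgebras.

(* f maps S to T and preserves the meets and joins of arbitrary non-empty     *)
(* families of members of S.                                                  *)
Definition complete_lattice_hom (A B : Type)
    (S : aclass (aclass A))
    (meetS joinS : forall I : Type, (I -> aclass A) -> aclass A)
    (T : aclass (aclass B))
    (meetT joinT : forall I : Type, (I -> aclass B) -> aclass B)
    (f : aclass A -> aclass B) : Prop :=
  (forall X, S X -> T (f X)) /\
  forall (I : Type) (X : I -> aclass A), inhabited I -> (forall i, S (X i)) ->
    class_eq (f (meetS I X)) (meetT I (fun i => f (X i))) /\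
    class_eq (f (joinS I X)) (joinT I (fun i => f (X i))).

(* Main.v *)
Require Import Defs.
From HB Require Import structures.
From mathcomp Require Import all_boot all_order all_algebra.

Set Implicit Arguments.
Unset Strict Implicit.
Unset Printing Implicit Defensive.

Import GRing.Theory.
Local Open Scope ring_scope.

(** Ordinary and restricted primitivity differ only on abelian algebras. If a
    self-centralising ideal [A] is given in a restricted algebra, then every
    [x] in [A] satisfies [ad x ^ 2 = 0], so that [pop x] is central. Hence when
    the centre is zero the p-operation vanishes on [A], all subideals of [A]
    are p-ideals, and the two notions of primitivity agree
    ([p_primitive_atom_or_centreless], [primitive_p_primitive]). When the
    centre is nonzero, minimality of [A] makes the whole algebra abelian: a
    primitive algebra is then one-dimensional (a line), a p-primitive one is
    an atom.

    A centreless algebra has at most one p-operation, because [pop x] is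
    determined by [ad (pop x) = ad x ^ p]. For the same reason every centreless
    Lie quotient of a restricted algebra inherits a p-operation: its kernel is
    automatically a p-ideal ([centreless_quotient_p_operation]).

    So the primitive and p-primitive quotients of a restricted algebra are the
    same ones, apart from lines on one side and atoms on the other. This is the
    content of [pPclosure_Pclosure]: a class [K] containing all atoms and a
    class [X] containing all lines have the same P-closure on restricted
    algebras, as soon as they agree on centreless primitive algebras. Taking
    for [X] a Schunck class, a union of skeletons, or [Und K] yields
    respectively that [Res] takes values in [pSch], that it preserves joins, and
    that [Res (Ord K)] is [K]. That the classes do contain the lines comes from
    [line_quotient]: a nonzero soluble algebra has every line as a quotient.

    Finally [Ord] is computed on primitive algebras, where it agrees with [Und]
    ([primitive_Ord]). Uniqueness of p-operations makes [Und] commute with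
    intersections on centreless algebras, and lines always belong to [Und K]
    since the zero p-operation turns them into atoms. *)

(** * Brackets, centres and abelian algebras *)

Section LieBasics.
Variable F : fieldType.
Implicit Types L M Q : lieAlgebra F.

HB.instance Definition _ L (z : L) :=
  GRing.isLinear.Build F L L *:%R (bracket z)
    (fun a x y => @bracketPr F L a x y z).

Lemma bracketC L (x y : L) : bracket x y = - bracket y x.
Proof.
have addl (u v w : L) : bracket (u + v) w = bracket u w + bracket v w.
  by rewrite -[u]scale1r bracketPl !scale1r.
apply/eqP; rewrite -addr_eq0; apply/eqP.
by have := bracketxx (x + y); rewrite addl !linearD /= !bracketxx add0r addr0.
Qed.

Lemma bracket0x L (x : L) : bracket 0 x = 0.
Proof. by rewrite bracketC linear0 oppr0. Qed.

Lemma bracketDl L (x y z : L) : bracket (x + y) z = bracket x z + bracket y z.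
Proof. by rewrite bracketC linearD opprD /= -!(bracketC _ z). Qed.

Lemma bracketZl L (a : F) (x z : L) : bracket (a *: x) z = a *: bracket x z.
Proof. by rewrite bracketC linearZ /= -scalerN -bracketC. Qed.

Lemma bracket_suml L I (r : seq I) (P : pred I) (G : I -> L) z :
  bracket (\sum_(i <- r | P i) G i) z = \sum_(i <- r | P i) bracket (G i) z.
Proof.
rewrite bracketC linear_sum -sumrN; apply: eq_bigr => i _ /=.
by rewrite -bracketC.
Qed.

Definition central L (z : L) := forall x, bracket z x = 0.

Definition abelian L := forall x : L, central x.

Definition centreless L := forall z : L, central z -> z = 0.

Definition centre L : {vspace L} :=
  (\bigcap_(i < \dim {:L}) lker (linfun (bracket (vbasis {:L})`_i)))%VS.

Lemma centreP L (z : L) : reflect (central z) (z \in centre L).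
Proof.
rewrite memvE; apply: (iffP subv_bigcapP) => [ker_z x | z_central i _].
  rewrite (coord_vbasis (memvf x)) linear_sum big1 //= => i _.
  have := ker_z i isT; rewrite -memvE memv_ker lfunE /= => /eqP zi0.
  by rewrite linearZ /= bracketC zi0 oppr0 scaler0.
by rewrite -memvE memv_ker lfunE /= bracketC z_central oppr0.
Qed.

Lemma memv_bracketv L (U V : {vspace L}) u v :
  u \in U -> v \in V -> bracket u v \in bracketv U V.
Proof.
move=> uU vV; rewrite (coord_vbasis uU) (coord_vbasis vV) bracket_suml.
apply: rpred_sum => i _; rewrite bracketZl rpredZ // linear_sum.
apply: rpred_sum => j _ /=; rewrite linearZ rpredZ //.
by apply/memv_span/allpairs_f; apply: mem_nth; rewrite size_tuple.
Qed.

Lemma bracketv_subv L (U V W : {vspace L}) :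
  (forall u v, u \in U -> v \in V -> bracket u v \in W) ->
  (bracketv U V <= W)%VS.
Proof.
move=> UVW; apply/span_subvP => _ /allpairsP[[u v] /= [uU vV ->]].
by apply: UVW; apply: vbasis_mem.
Qed.

Lemma abelian_soluble L : abelian L -> soluble L.
Proof.
move=> abL; exists 1%N; apply/eqP; rewrite -subv0.
by apply: bracketv_subv => u v _ _; rewrite abL mem0v.
Qed.

Lemma surjective_lfun L M (f : 'Hom(L, M)) :
  limg f = fullv -> forall y, exists x, y = f x.
Proof.
by move=> fM y; have := memvf y; rewrite -fM => /memv_imgP[x _ ->]; exists x.
Qed.

Lemma lker_ideal L M (f : 'Hom(L, M)) : lie_morphism f -> ideal (lker f).
Proof.
by move=> fL x y; rewrite !memv_ker fL => /eqP->; rewrite bracket0x.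
Qed.

Lemma soluble_quotient L Q (f : 'Hom(L, Q)) :
  lie_morphism f -> limg f = fullv -> soluble L -> soluble Q.
Proof.
move=> fL fQ [n Ln0]; exists n; apply/eqP; rewrite -subv0 -(limg0 f) -Ln0.
elim: n {Ln0} => [|n IHn]; first by rewrite /= fQ subvv.
apply: bracketv_subv => u v /(subvP IHn)/memv_imgP[x xL ->].
move=> /(subvP IHn)/memv_imgP[y yL ->].
by rewrite -fL memv_img // memv_bracketv.
Qed.

Lemma abelian_quotient L Q (f : 'Hom(L, Q)) :
  lie_morphism f -> limg f = fullv -> abelian L -> abelian Q.
Proof.
move=> fL /surjective_lfun fQ abL x y.
by have [[u ->] [v ->]] := (fQ x, fQ y); rewrite -fL abL linear0.
Qed.

Lemma lie_morphism_comp L M Q (f : 'Hom(L, M)) (g : 'Hom(M, Q)) :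
  lie_morphism f -> lie_morphism g -> lie_morphism (g \o f)%VF.
Proof. by move=> fL gL x y; rewrite !lfunE /= fL gL. Qed.

Lemma lie_morphism_id L : lie_morphism (\1 : 'Hom(L, L))%VF.
Proof. by move=> x y; rewrite !lfunE. Qed.

Lemma lie_morphism_iter L M (f : 'Hom(L, M)) n x z :
  lie_morphism f -> f (iter n (bracket x) z) = iter n (bracket (f x)) (f z).
Proof. by move=> fL; elim: n => //= n IHn; rewrite fL IHn. Qed.

(** Meant for [n = p]: the identity [ad (pop x) = ad x ^ p] cannot be expanded
    by rewriting [p], on which the type of a restricted algebra depends. *)
Lemma iter_bracket_eq0 L k n (x z : L) :
  (k <= n)%N -> iter k (bracket x) z = 0 -> iter n (bracket x) z = 0.
Proof.
move=> /subnK <-; rewrite iterD => ->.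
by elim: (n - k)%N => //= m ->; rewrite linear0.
Qed.

(** * Lines and primitive algebras *)

Definition line L := \dim {:L} = 1%N.

Lemma line_basis L :
  line L -> exists2 m : L, m != 0 & forall x, exists a, x = a *: m.
Proof.
move=> dimL; have : vpick {:L} != 0.
  by rewrite vpick0 -dimv_eq0 dimL.
set m := vpick _ => m0; exists m => // x; apply/vlineP.
have -> // : <[m]>%VS = fullv; last exact: memvf.
by apply/eqP; rewrite eqEdim subvf dimL dim_vline m0.
Qed.

Lemma line_abelian L : line L -> abelian L.
Proof.
move=> /line_basis[m _ mL] x y; have [[a ->] [b ->]] := (mL x, mL y).
by rewrite bracketZl linearZ /= bracketxx !scaler0.
Qed.

Lemma line_subv L (U : {vspace L}) : line L -> U = 0%VS \/ U = fullv.
Proof.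
move=> dimL; case: (eqVneq U 0%VS) => [|U0]; [by left | right].
by apply/eqP; rewrite eqEdim subvf dimL lt0n dimv_eq0.
Qed.

Lemma abelian_self_centralising L :
  abelian L -> self_centralising (fullv : {vspace L}).
Proof. by move=> abL x; split=> [_ | _ a _]; [exact: memvf | exact: abL]. Qed.

Lemma line_primitive L : line L -> primitive L.
Proof.
move=> dimL; exists fullv; split; last first.
  exact/abelian_self_centralising/line_abelian.
split=> [x y _ | L0 | B _ _ B0]; first exact: memvf.
  by move: dimL; rewrite /line L0 dimv0.
by have [] := line_subv B dimL.
Qed.

(** A central [z] lies in the self-centralising minimal ideal, and the line it
    spans is an ideal, hence is that minimal ideal; as a central ideal, its
    centraliser is everything. *)
Lemma primitive_line_or_centreless L : primitive L -> line L \/ centreless L.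
Proof.
move=> [A [[_ _ minA] selfA]].
case: (eqVneq (centre L) 0%VS) => [Z0 | Z0]; [right=> z /centreP | left].
  by rewrite Z0 memv0 => /eqP.
have z0 : vpick (centre L) != 0 by rewrite vpick0.
have := memv_pick (centre L); move: (vpick _) z0 => z z0 /centreP zc.
have zA : z \in A by apply/selfA => a _.
have defA : <[z]>%VS = A.
  apply: minA => [x y /vlineP[a ->] | |]; last 2 first.
  - by rewrite -memvE.
  - by move/eqP; rewrite -dimv_eq0 dim_vline z0.
  by rewrite bracketZl zc scaler0 mem0v.
suff AL : A = fullv by rewrite /line -AL -defA dim_vline z0.
apply/vspaceP=> x; rewrite memvf; apply/selfA.
move=> a; rewrite -defA => /vlineP[b ->].
by rewrite bracketC bracketZl zc scaler0 oppr0.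
Qed.

End LieBasics.

(** * Lines are quotients of soluble algebras *)

Section LineQuotients.
Variable F : fieldType.
Implicit Types L M : lieAlgebra F.

Lemma soluble_bracketv L :
  soluble L -> nonzero L -> bracketv fullv fullv <> (fullv : {vspace L}).
Proof.
move=> [n Ln0] [x x0] L'L; apply: x0; apply/eqP.
suff LnL : derived_series L n = fullv by rewrite -memv0 -Ln0 LnL memvf.
by elim: n {Ln0} => //= n ->.
Qed.

(** A nonzero soluble algebra differs from its derived algebra [L'], and any
    linear form vanishing on [L'] is a Lie morphism to a line. *)
Lemma line_quotient L M :
  soluble L -> nonzero L -> line M ->
  exists f : 'Hom(L, M), lie_morphism f /\ limg f = fullv.
Proof.
move=> solL nzL lineM; have [m m0 mM] := line_basis lineM.
have := soluble_bracketv solL nzL; set L' := bracketv _ _ => /eqP properL'.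
pose C := (L'^C)%VS.
have C_gt0 : (0 < \dim C)%N.
  rewrite lt0n dimv_eq0; apply: contraNneq properL' => C0.
  by rewrite -(addv_complf L') -/C C0 addv0.
(* Any coordinate on the complement [C], extended by zero on [L'], will do. *)
move: (Ordinal C_gt0) => i.
have capC : (C :&: L' = 0)%VS by rewrite capvC capv_compl.
pose f0 v : M := coord (vbasis C) i (daddv_pi C L' v) *: m.
have f0_linear : linear f0.
  by move=> a u v; rewrite /f0 !linearP /= scalerDl scalerA.
pose f := linfun (HB.pack f0 (GRing.isLinear.Build F L M *:%R f0 f0_linear)
                    : {linear L -> M}).
have fE v : f v = f0 v by rewrite lfunE.
exists f; split=> [x y|].
  rewrite (line_abelian lineM) fE /f0.
  have xyL' : bracket x y \in L' by rewrite memv_bracketv ?memvf.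
  have : bracket x y \in (C + L')%VS by rewrite addvC addv_complf memvf.
  move/(daddv_pi_add capC).
  rewrite (daddv_pi_id _ xyL') 1?capvC // => /(canRL (addrK _)).
  by rewrite subrr => ->; rewrite !linear0 scale0r.
apply/vspaceP=> y; rewrite memvf; have [a ->] := mM y.
apply/memv_imgP; exists (a *: (vbasis C)`_i); first exact: memvf.
rewrite fE /f0 !linearZ /= daddv_pi_id ?(vbasis_mem, mem_nth, size_tuple) //.
by rewrite coord_free ?(basis_free (vbasisP C)) // eqxx mulr1.
Qed.

End LineQuotients.

(** * Restricted algebras *)

Section Restricted.
Variables (F : fieldType) (p : nat) (p_prime : prime p).
Implicit Types (L M Q : lieAlgebra F) (A : restrictedLie F p).

(** The centraliser of a single [x] is a p-subalgebra: if [u] commutes with [x],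
    then [ad (pop u) x = ad u ^ p x = 0]. It contains [x], so it is not zero
    unless [x] is. *)
Lemma atom_abelian A : atom A -> abelian A.
Proof.
move=> [_ _ subA] x y.
have : p_subalgebra (lker (linfun (bracket x))).
  split=> [u v | u]; rewrite !memv_ker !lfunE /= => /eqP xu.
    move=> /eqP xv; have := jacobi x u v.
    by rewrite xu (bracketC v x) xv oppr0 !linear0 !addr0 => ->.
  rewrite bracketC; have [-> _ _] := popP A.
  rewrite oppr_eq0; apply/eqP.
  by apply: iter_bracket_eq0 (prime_gt0 p_prime) _; rewrite /= bracketC xu oppr0.
move=> /subA[ker0 | kerT]; last first.
  by have := memvf y; rewrite -kerT memv_ker lfunE => /eqP.
have : x \in lker (linfun (bracket x)) by rewrite memv_ker lfunE /= bracketxx.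
by rewrite ker0 memv0 => /eqP->; rewrite bracket0x.
Qed.

Lemma pop_central A z : central z -> central (pop (z : A)).
Proof.
have [zp _ _] := popP A; move=> zc x; rewrite zp.
exact: iter_bracket_eq0 (prime_gt0 p_prime) (zc x).
Qed.

(** Self-centralising ideals are abelian, so [ad x] maps everything into [I] and
    then to zero: [ad x ^ 2 = 0] and a fortiori [ad (pop x) = 0]. *)
Lemma abelian_ideal_pop_central A (I : {vspace A}) x :
  ideal I -> self_centralising I -> x \in I -> central (pop x).
Proof.
move=> idI selfI xI z; have [-> _ _] := popP A.
apply: iter_bracket_eq0 (prime_gt1 p_prime) _ => /=.
by have /selfI := xI; apply; apply: idI.
Qed.

Lemma atom_p_primitive A : atom A -> p_primitive A.
Proof.
move=> atomA; have abA := atom_abelian atomA.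
have [[x x0] _ subA] := atomA; exists fullv.
split; last exact: abelian_self_centralising.
split=> [|A0|B [idB stabB] _ B0]; first by split=> [? ? _|? _]; exact: memvf.
  by apply/x0/eqP; rewrite -memv0 -A0 memvf.
have /subA[/B0 | ] // : p_subalgebra B by split=> // u v uB _; exact: idB.
Qed.

(** The centre is a p-ideal contained in the minimal p-ideal [I]. If it is
    nonzero, it equals [I], and the algebra, being the centraliser of [I], is
    abelian without proper p-ideals. If it is zero, [pop] vanishes on [I], and
    [I] is already minimal among ordinary ideals. *)
Lemma p_primitive_atom_or_centreless A :
  p_primitive A -> atom A \/ primitive A /\ centreless A.
Proof.
move=> [I [[[idI stabI] I0 minI] selfI]].
have centre_sub : (centre A <= I)%VS.
  by apply/subvP=> z /centreP zc; apply/selfI=> a _.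
case: (eqVneq (centre A) 0%VS) => [Z0 | /eqP Z0]; [right | left].
  have cless : centreless A by move=> z /centreP; rewrite Z0 memv0 => /eqP.
  split=> //; exists I; split=> //; split=> // J idJ JI J0; apply: minI => //.
  split=> // x xJ; rewrite [pop x]cless ?mem0v //.
  by apply: abelian_ideal_pop_central idI selfI _; apply: subvP xJ.
have defI : centre A = I.
  apply: minI => //; split=> [x y /centreP xc | x /centreP xc].
    by rewrite xc mem0v.
  exact/centreP/pop_central.
have IT : I = fullv.
  apply/vspaceP=> x; rewrite memvf; apply/selfI=> a.
  by rewrite -defI => /centreP ac; rewrite bracketC ac oppr0.
have abA : abelian A by move=> x; apply/centreP; rewrite defI IT memvf.
split=> [||U [_ stabU]]; last 1 first.
- case: (eqVneq U 0%VS) => [|/eqP U0]; [by left | right].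
  rewrite -IT; apply: minI => //; last by rewrite IT subvf.
  by split=> // x y _; rewrite abA mem0v.
- by exists (vpick I); apply/eqP; rewrite vpick0; apply/eqP.
exact: abelian_soluble.
Qed.

Lemma primitive_p_primitive A : primitive A -> centreless A -> p_primitive A.
Proof.
move=> [I [[idI I0 minI] selfI]] cless; exists I; split=> //.
split=> // [|J [idJ _]]; last exact: minI.
split=> // x xI; rewrite [pop x]cless ?mem0v //.
exact: abelian_ideal_pop_central idI selfI xI.
Qed.

Lemma jacobson_s_morphism L M (f : 'Hom(L, M)) i x y :
  lie_morphism f -> f (jacobson_s p i x y) = jacobson_s p i (f x) (f y).
Proof.
move=> fL; rewrite /jacobson_s linearZ /=; congr (_ *: _).
rewrite /jacobson_poly; elim: p.-1 i.-1 => [|n IHn] k /=.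
  by case: eqP; rewrite ?linear0.
rewrite /ad_tx_y linearD /= fL IHn.
by case: k => [|k]; rewrite ?linear0 // fL IHn.
Qed.

(** In [Q] the adjoint of [f (pop x)] is the [p]-th power of the adjoint of
    [f x], and an element of a centreless algebra is determined by its
    adjoint. *)
Lemma pop_centreless_quotient A Q (f : 'Hom(A, Q)) x y :
  lie_morphism f -> limg f = fullv -> centreless Q ->
  f x = f y -> f (pop x) = f (pop y).
Proof.
move=> fL /surjective_lfun fQ cless fxy.
apply/eqP; rewrite -subr_eq0; apply/eqP/cless => z; have [t ->] := fQ z.
have [popE _ _] := popP A.
rewrite bracketDl -scaleN1r bracketZl scaleN1r -!fL !popE.
by rewrite !lie_morphism_iter // fxy subrr.
Qed.

(** The kernel of [f] is automatically a p-ideal: [f (pop x)] depends only on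
    [f x]. So any linear section of [f] defines the same p-operation on [Q],
    for which the axioms are pushed forward along [f]. *)
Lemma centreless_quotient_p_operation A Q (f : 'Hom(A, Q)) :
  lie_morphism f -> limg f = fullv -> centreless Q ->
  exists q (qP : p_operation p q), restricted_morphism (M := RestrictedLie qP) f.
Proof.
move=> fL fQ cless; pose q (y : Q) := f (pop (f^-1%VF y : A)).
have qf x : q (f x) = f (pop x).
  apply: pop_centreless_quotient => //.
  by rewrite limg_lfunVK // memv_img ?memvf.
have [popE popZ popD] := popP A; have surj := surjective_lfun fQ.
suff qP : p_operation p q by exists q, qP; split=> // x; rewrite /= qf.
split=> [y z | a y | y z].
- have [[x ->] [t ->]] := (surj y, surj z).
  by rewrite qf -fL popE lie_morphism_iter.
- by have [x ->] := surj y; rewrite -linearZ !qf popZ linearZ.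
have [[x ->] [t ->]] := (surj y, surj z); rewrite -linearD !qf popD !linearD /=.
congr (_ + _); rewrite linear_sum; apply: eq_bigr => i _.
exact: jacobson_s_morphism.
Qed.

Lemma centreless_p_operation_unique L (q r : L -> L) :
  centreless L -> p_operation p q -> p_operation p r -> q =1 r.
Proof.
move=> cless [qE _ _] [rE _ _] x; apply/eqP; rewrite -subr_eq0; apply/eqP/cless.
by move=> z; rewrite bracketDl -scaleN1r bracketZl scaleN1r qE rE subrr.
Qed.

(** Every term of Jacobson's formula contains [p - 1 > 0] brackets. *)
Lemma abelian_zero_p_operation L : abelian L -> p_operation p (fun _ : L => 0).
Proof.
move=> abL; have p2 : p = p.-2.+2 by case: p p_prime => [|[]].
split=> [x z | a x | x y].
- by rewrite p2 /= bracket0x abL.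
- by rewrite scaler0.
rewrite big1 ?addr0 // => i _; rewrite /jacobson_s /jacobson_poly p2 /= /ad_tx_y.
by case: i.-1 => [|k]; rewrite !abL addr0 scaler0.
Qed.

Lemma line_atom A : line A -> atom A.
Proof.
move=> lineA; have [m /eqP m0 _] := line_basis lineA.
split=> [||U _]; [by exists m | exact/abelian_soluble/line_abelian |].
exact: line_subv.
Qed.

End Restricted.

(** * Closure operators and Schunck classes *)

Section Closures.
Variables (F : fieldType) (p : nat) (p_prime : prime p).
Implicit Types (L M Q : lieAlgebra F) (A B : restrictedLie F p).
Implicit Types (X Y : aclass (lieAlgebra F)) (K : aclass (restrictedLie F p)).

(** Quotients are handled through their projections: the kernel is determined
    by the projection and is an ideal for free. *)
Lemma PclosureP X L :
  Pclosure X L <-> soluble L /\ forall Q (f : 'Hom(L, Q)),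
    lie_morphism f -> limg f = fullv -> primitive Q -> X Q.
Proof.
split=> -[solL XL]; split=> //.
  by move=> Q f fL fQ; apply: (XL (lker f)); [exact: lker_ideal | exists f].
by move=> U Q _ [f [fL fQ _]]; apply: XL fL fQ.
Qed.

Lemma pPclosureP K A :
  pPclosure K A <-> soluble A /\ forall B (f : 'Hom(A, B)),
    restricted_morphism f -> limg f = fullv -> p_primitive B -> K B.
Proof.
split=> -[solA KA]; split=> //.
  move=> B f [fL fp] fB; apply: (KA (lker f)); last by exists f.
  split=> [|x]; first exact: lker_ideal.
  rewrite !memv_ker fp => /eqP->; have [_ popZ _] := popP B.
  have := popZ 0 0; rewrite scale0r expr0n gtn_eqF ?prime_gt0 // scale0r.
  by move=> ->.
by move=> U B _ [f [fL fB _]]; apply: KA fL fB.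
Qed.

Lemma restricted_morphism_id A : restricted_morphism (\1 : 'Hom(A, A))%VF.
Proof. by split=> [|x]; [exact: lie_morphism_id | rewrite !lfunE]. Qed.

Lemma Pclosure_primitive X Q : Pclosure X Q -> primitive Q -> X Q.
Proof.
move=> /PclosureP[_ XQ]; apply: (XQ _ \1%VF (@lie_morphism_id _ _)).
by rewrite lim1g.
Qed.

Lemma pPclosure_primitive K A : pPclosure K A -> p_primitive A -> K A.
Proof.
move=> /pPclosureP[_ KA]; apply: (KA _ \1%VF (@restricted_morphism_id _)).
by rewrite lim1g.
Qed.

Lemma Pclosure_quotient X L Q (f : 'Hom(L, Q)) :
  lie_morphism f -> limg f = fullv -> Pclosure X L -> Pclosure X Q.
Proof.
move=> fL fQ /PclosureP[solL XL]; apply/PclosureP; split.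
  exact: soluble_quotient fL fQ solL.
move=> M g gL gM; apply: (XL M (g \o f)%VF); first exact: lie_morphism_comp.
by rewrite limg_comp fQ.
Qed.

Lemma Pclosure_mono X Y L :
  (forall Q, primitive Q -> X Q -> Y Q) -> Pclosure X L -> Pclosure Y L.
Proof.
move=> XY /PclosureP[solL XL]; apply/PclosureP; split=> // Q f fL fQ primQ.
exact/XY/(XL Q f).
Qed.

(** The primitive quotients of an abelian algebra are lines: an abelian
    centreless algebra is zero, hence not primitive. *)
Lemma Pclosure_abelian X L :
  (forall Q, line Q -> X Q) -> abelian L -> Pclosure X L.
Proof.
move=> lineX abL; apply/PclosureP; split=> [|Q f fL fQ primQ].
  exact: abelian_soluble.
have [/lineX // | cless] := primitive_line_or_centreless primQ.
have [I [[_ I0 _] _]] := primQ; case: I0; apply/eqP; rewrite -subv0.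
apply/subvP=> x _; rewrite memv0; apply/eqP/cless.
exact: abelian_quotient fL fQ abL x.
Qed.

Lemma Pclosure_schunck X : (exists L, Pclosure X L) -> schunck (Pclosure X).
Proof.
move=> inhX; split=> // [L M [f [fL bij_f]]|].
  apply: (Pclosure_quotient fL); apply/vspaceP=> y; rewrite memvf.
  by have [g _ gK] := bij_f; rewrite -(gK y) memv_img ?memvf.
move=> L; split=> [/PclosureP[solL XL] | XL]; apply/PclosureP.
  by split=> // Q f fL fQ primQ; apply: Pclosure_primitive (XL Q f fL fQ primQ) _.
split=> [|Q f fL fQ _]; first by case/PclosureP: XL.
exact: Pclosure_quotient fL fQ XL.
Qed.

(** The comparison of the two closure operators on a restricted algebra [A].
    Its primitive quotients are lines or centreless; the latter inherit a
    p-operation and become p-primitive. Conversely its p-primitive quotients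
    are atoms or centreless primitive. *)
Lemma pPclosure_Pclosure K X A :
  (forall B, atom B -> K B) -> (forall Q, line Q -> X Q) ->
  (forall B, primitive B -> centreless B -> K B <-> X B) ->
  pPclosure K A <-> Pclosure X A.
Proof.
move=> atomK lineX KX; split=> [/pPclosureP | /PclosureP] [solA clA].
  apply/PclosureP; split=> // Q f fL fQ primQ.
  have [/lineX // | cless] := primitive_line_or_centreless primQ.
  have [q [qP fp]] := centreless_quotient_p_operation fL fQ cless.
  apply/(KX (RestrictedLie qP)) => //; apply: (clA (RestrictedLie qP) f) => //.
  exact: (primitive_p_primitive p_prime (A := RestrictedLie qP)).
apply/pPclosureP; split=> // B f [fL _] fB.
move=> /(p_primitive_atom_or_centreless p_prime)[/atomK // | [primB cless]].
exact/KX/(clA B f).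
Qed.

Lemma exists_line : exists L, line L.
Proof.
have zeroP (a : F) (x y z : F^o) : 0 = a *: 0 + 0 :> F^o.
  by rewrite scaler0 addr0.
have zero_jacobi (x y z : F^o) : 0 + 0 + 0 = 0 :> F^o by rewrite !addr0.
exists (LieAlgebra (bracket := fun _ _ : F^o => 0)
  zeroP zeroP (fun => erefl) zero_jacobi).
by rewrite /line dimvf.
Qed.

Lemma Sch_line X L : Sch X -> line L -> X L.
Proof.
move=> [[_ _ PX] [M [/PX/PclosureP[solM XM] nzM]]] lineL.
have [f [fM fL]] := line_quotient solM nzM lineL.
exact/(XM L f)/line_primitive.
Qed.

Lemma line_atom_structure L : line L ->
  exists q (qP : p_operation p q), atom (RestrictedLie (underlying := L) qP).
Proof.
move=> lineL.
exists _, (abelian_zero_p_operation p_prime (line_abelian lineL)).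
exact: line_atom.
Qed.

Lemma pSch_line K L : pSch K -> line L -> Und K L.
Proof.
move=> [_ atomK] /line_atom_structure[q [qP /atomK Kq]].
by exists q, qP.
Qed.

Lemma in_Und K A : K A -> Und K A.
Proof. by case: A => L q qP KA; exists q, qP. Qed.

(** The p-operation witnessing membership in [Und K] need not be that of [A] by
    definition; uniqueness makes the identity a restricted isomorphism. *)
Lemma centreless_Und K A : p_iso_closed K -> centreless A -> Und K A -> K A.
Proof.
move=> isoK cless [q [qP Kq]]; apply: isoK Kq; exists \1%VF.
split; last by exists id => x; rewrite lfunE.
split=> [|x]; first exact: lie_morphism_id.
by rewrite !lfunE /=; apply: centreless_p_operation_unique cless qP (popP A) x.
Qed.

Lemma pSch_Res X : Sch X -> pSch (Res (p := p) X).
Proof.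
move=> SchX; have [[isoX _ PX] _] := SchX; have lineX L := @Sch_line X L SchX.
have atomX A : atom A -> X A.
  by move=> /(atom_abelian p_prime) abA; apply/PX/Pclosure_abelian.
split=> //; split=> [A B [f [[fL _] bij_f]] | | A].
- by apply: isoX; exists f.
- have [L /line_atom_structure[q [qP /atomX Xq]]] := exists_line.
  by exists (RestrictedLie qP).
apply: iff_trans (PX A); exact: pPclosure_Pclosure.
Qed.

Lemma Res_Ord K : pSch K -> class_eq (Res (Ord K)) K.
Proof.
move=> pSchK A; have [[isoK _ PK] atomK] := pSchK.
apply: iff_trans (PK A); apply: iff_sym; apply: pPclosure_Pclosure => //.
  by move=> Q; apply: pSch_line.
by move=> B _ cless; split; [exact: in_Und | exact: centreless_Und].
Qed.

Lemma Sch_Ord K : pSch K -> Sch (Ord K).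
Proof.
move=> pSchK; have [L lineL] := exists_line.
have OrdL : Ord K L.
  by apply: Pclosure_abelian (line_abelian lineL) => Q; apply: pSch_line.
split; first by apply: Pclosure_schunck; exists L.
by have [m /eqP m0 _] := line_basis lineL; exists L; split=> //; exists m.
Qed.

(** The implication from [Und K] to [Ord K] is not formal: [Und K] is
    contained in [Ord K] because [K = Res (Ord K)]. *)
Lemma primitive_Ord K Q : pSch K -> primitive Q -> Ord K Q <-> Und K Q.
Proof.
move=> pSchK primQ; split=> [OrdQ|]; first exact: Pclosure_primitive OrdQ primQ.
by move=> [q [qP /(Res_Ord pSchK)]].
Qed.

Lemma Res_join (I : Type) (X : I -> aclass (lieAlgebra F)) :
  inhabited I -> (forall i, Sch (X i)) ->
  class_eq (Res (sch_join X)) (psch_join (fun i => Res (p := p) (X i))).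
Proof.
move=> [i0] SchX A; apply: iff_sym; apply: pPclosure_Pclosure.
- move=> B atomB; exists i0; split; last exact: atom_p_primitive.
  by have [_] := pSch_Res (SchX i0); apply.
- by move=> Q lineQ; exists i0; split; [exact: Sch_line | exact: line_primitive].
move=> B primB cless; split=> -[i [XB _]]; exists i; split=> //.
exact: primitive_p_primitive.
Qed.

(** Different members of the family may witness [Und (K i) Q] with different
    p-operations on [Q]. On a line the zero p-operation serves them all, since
    it gives an atom; on a centreless [Q] there is only one p-operation. *)
Lemma Ord_meet (I : Type) (K : I -> aclass (restrictedLie F p)) :
  inhabited I -> (forall i, pSch (K i)) ->
  class_eq (Ord (psch_meet K)) (sch_meet (fun i => Ord (K i))).
Proof.
move=> [i0] pSchK L; split=> [OrdL i | OrdL].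
  apply: Pclosure_mono OrdL => Q _ [q [qP Kq]].
  by exists q, qP.
have [solL _] := OrdL i0; apply/PclosureP; split=> // Q f fL fQ primQ.
have UndQ i : Und (K i) Q.
  by have /PclosureP[_ UndL] := OrdL i; apply: UndL fL fQ primQ.
have [lineQ | cless] := primitive_line_or_centreless primQ.
  have [q [qP atomq]] := line_atom_structure lineQ.
  by exists q, qP => i; have [_] := pSchK i; apply.
have [q [qP _]] := UndQ i0; exists q, qP => i.
have [[isoK _ _] _] := pSchK i.
exact: (centreless_Und (A := RestrictedLie qP)).
Qed.

(** By [primitive_Ord] both closures are governed by the primitive members of
    the classes [Und (K i)]. A centreless primitive algebra with a p-operation
    is p-primitive, hence among its own p-primitive quotients; a line belongs
    to every [Und (K i)], and here the family has to be non-empty. *)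
Lemma Ord_join (I : Type) (K : I -> aclass (restrictedLie F p)) :
  inhabited I -> (forall i, pSch (K i)) ->
  class_eq (Ord (psch_join K)) (sch_join (fun i => Ord (K i))).
Proof.
move=> [i0] pSchK L; split; apply: Pclosure_mono => Q primQ.
  move=> [q [qP joinq]].
  suff [i UndQ] : exists i, Und (K i) Q.
    by exists i; split=> //; apply/primitive_Ord.
  have [lineQ | cless] := primitive_line_or_centreless primQ.
    by exists i0; apply: pSch_line.
  have p_primQ : p_primitive (RestrictedLie qP) by apply: primitive_p_primitive.
  have [i [Kq _]] := pPclosure_primitive joinq p_primQ.
  by exists i, q, qP.
move=> [i [/primitive_Ord-/(_ (pSchK i) primQ)[q [qP Kq]] _]]; exists q, qP.
have [[_ _ PK] _] := pSchK i; have /PK/pPclosureP[solQ KQ] := Kq.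
apply/pPclosureP; split=> // B f fp fB primB.
by exists i; split=> //; apply: KQ fp fB primB.
Qed.

End Closures.

Theorem theorem8p11 (F : fieldType) (p : nat) (charFp : p \in [pchar F]%R) :
  [/\ complete_lattice_hom
        (@Sch F) (@sch_meet F) (@sch_join F)
        (@pSch F p) (@psch_meet F p) (@psch_join F p)
        (@Res F p),
      complete_lattice_hom
        (@pSch F p) (@psch_meet F p) (@psch_join F p)
        (@Sch F) (@sch_meet F) (@sch_join F)
        (@Ord F p) &
      forall K : aclass (restrictedLie F p), @pSch F p K -> class_eq (Res (Ord K)) K].
Proof.
have p_prime := pcharf_prime charFp; split.
- split=> [X | I X inhI SchX]; first exact: pSch_Res.
  by split; [move=> A | exact: Res_join].
- split=> [K | I K inhI pSchK]; first exact: Sch_Ord.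
  by split; [exact: Ord_meet | exact: Ord_join].
by move=> K; apply: Res_Ord.
Qed.
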